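(* Let $\mathfrak M$ be a category with both an initial object $\emptyset$ and a final object $*$. Then the simplicial category $\mathbb N_\bullet(\mathfrak M)$ (the categorical nerve) has the property that, between $\mathbb N_n(\mathfrak M)$ and $\mathbb N_{n-1}(\mathfrak M)$ ($n\ge1$), for $0\le i\le n-1$ both $(d_i,s_i)$ and $(s_i,d_{i+1})$ are adjoint pairs, and in addition $(\overline s_{-1},d_0)$ and $(d_n,\overline s_n)$ are adjoint pairs (left adjoint written first). Furthermore, the only new entries introduced by any of these functors are the initial and final objects; that is, every entry of the value of one of these functors on a diagram is either an entry of that diagram or $\emptyset$ or $*$.
   Context: $\mathbb N_n(\mathfrak M)=\mathrm{Fun}([n],\mathfrak M)$ is the category of chains $X_0\to X_1\to\dots\to X_n$ in $\mathfrak M$ with natural transformations as morphisms. The face functor $d_i:\mathbb N_n(\mathfrak M)\to\mathbb N_{n-1}(\mathfrak M)$, $0\le i\le n$, removes the object $X_i$ (composing the adjacent maps if $i\neq0,n$). The degeneracy functor $s_i:\mathbb N_{n-1}(\mathfrak M)\to\mathbb N_n(\mathfrak M)$, $0\le i\le n-1$, inserts the identity on the $i$-th object. The functors $\overline s_{-1},\overline s_n:\mathbb N_{n-1}(\mathfrak M)\to\mathbb N_n(\mathfrak M)$ are given by $\overline s_{-1}(X_0\to\dots\to X_{n-1})=(\emptyset\to X_0\to\dots\to X_{n-1})$ and $\overline s_n(X_0\to\dots\to X_{n-1})=(X_0\to\dots\to X_{n-1}\to * )$. *)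

(* Defs.v *)
From mathcomp Require Import all_boot.
From Stdlib Require Import FunctionalExtensionality ProofIrrelevance.

Set Implicit Arguments.
Unset Strict Implicit.
Unset Printing Implicit Defensive.

Declare Scope cat_scope.
Delimit Scope cat_scope with cat.
Local Open Scope cat_scope.

#[local] Obligation Tactic := idtac.

(* Equality of morphisms, functors, etc. is Leibniz equality; proof
   irrelevance and functional extensionality make this the usual one. *)

Record Category := MkCategory {
  Ob :> Type;
  Hom : Ob -> Ob -> Type;
  idm : forall a, Hom a a;
  comp : forall a b c, Hom b c -> Hom a b -> Hom a c;
  comp1m : forall a b (f : Hom a b), comp (idm b) f = f;
  compm1 : forall a b (f : Hom a b), comp f (idm a) = f;
  compA : forall a b c d (h : Hom c d) (g : Hom b c) (f : Hom a b),
    comp h (comp g f) = comp (comp h g) f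
}.
Arguments Hom {_} a b.
Arguments idm {_} a.
Notation "g ∘ f" := (comp g f)
  (at level 40, left associativity) : cat_scope.

Record Functor (C D : Category) := MkFunctor {
  fob :> C -> D;
  fmap : forall a b : C, Hom a b -> Hom (fob a) (fob b);
  fmap1 : forall a, fmap (idm a) = idm (fob a);
  fmapM : forall a b c (g : Hom b c) (f : Hom a b),
    fmap (g ∘ f) = fmap g ∘ fmap f
}.
Arguments fmap {C D} _ {a b} f.

Record NatTrans (C D : Category) (F G : Functor C D) := MkNatTrans {
  ncomp :> forall a, Hom (F a) (G a);
  natP : forall a b (f : Hom a b), ncomp b ∘ fmap F f = fmap G f ∘ ncomp a
}.

Lemma nat_ext (C D : Category) (F G : Functor C D) (s t : NatTrans F G) :
  (forall a, s a = t a) -> s = t.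
Proof.
case: s t => [s sP] [t tP] /= st.
have {}st : s = t by apply: functional_extensionality_dep.
by subst t; rewrite (proof_irrelevance _ sP tP).
Qed.

(* A morphism packed with its endpoints, to compare morphisms whose endpoints
   are equal but not convertible. *)
Definition arrow (C : Category) := {a : C & {b : C & Hom a b}}.
Definition pack (C : Category) (a b : C) (f : Hom a b) : arrow C :=
  existT _ a (existT _ b f).

Lemma pack_inj (C : Category) (a b : C) (f g : Hom a b) :
  pack f = pack g -> f = g.
Proof. by move=> fg; do 2 apply inj_pair2 in fg. Qed.

Lemma functor_ext (C D : Category) (F G : Functor C D) :
  (forall a, F a = G a) ->
  (forall a b (f : Hom a b), pack (fmap F f) = pack (fmap G f)) -> F = G.
Proof.
case: F G => [F mF F1 FM] [G mG G1 GM] /= FG.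
have {}FG : F = G by apply: functional_extensionality_dep.
subst G => mFG.
have {}mFG : mF = mG.
  apply: functional_extensionality_dep => a.
  apply: functional_extensionality_dep => b.
  apply: functional_extensionality_dep => f.
  exact: pack_inj.
by subst mG; rewrite (proof_irrelevance _ F1 G1) (proof_irrelevance _ FM GM).
Qed.

Program Definition functor_id (C : Category) : Functor C C :=
  @MkFunctor C C id (fun _ _ f => f) _ _.
Next Obligation. by []. Qed.
Next Obligation. by []. Qed.

Program Definition functor_comp (C D E : Category)
    (G : Functor D E) (F : Functor C D) : Functor C E :=
  @MkFunctor C E (fun a => G (F a)) (fun _ _ f => fmap G (fmap F f)) _ _.
Next Obligation. by move=> C D E G F a /=; rewrite !fmap1. Qed.
Next Obligation. by move=> C D E G F a b c g f /=; rewrite !fmapM. Qed.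

Program Definition nat_id (C D : Category) (F : Functor C D) : NatTrans F F :=
  MkNatTrans (ncomp := fun a => idm (F a)) _.
Next Obligation. by move=> C D F a b f /=; rewrite comp1m compm1. Qed.

Program Definition nat_comp (C D : Category) (F G H : Functor C D)
    (t : NatTrans G H) (s : NatTrans F G) : NatTrans F H :=
  MkNatTrans (ncomp := fun a => t a ∘ s a) _.
Next Obligation.
by move=> C D F G H t s a b f /=; rewrite -compA natP compA natP compA.
Qed.

Program Definition functor_cat (C D : Category) : Category :=
  @MkCategory (Functor C D) (@NatTrans C D) (@nat_id C D) (@nat_comp C D) _ _ _.
Next Obligation. by move=> C D F G s; apply: nat_ext => a; apply: comp1m. Qed.
Next Obligation. by move=> C D F G s; apply: nat_ext => a; apply: compm1. Qed.
Next Obligation.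
by move=> C D F G H K u t s; apply: nat_ext => a; apply: compA.
Qed.

Program Definition whisker (B C D : Category) (T : Functor B C)
    (F G : Functor C D) (s : NatTrans F G) :
    NatTrans (functor_comp F T) (functor_comp G T) :=
  MkNatTrans (ncomp := fun b => s (T b)) _.
Next Obligation. by move=> B C D T F G s a b f /=; apply: natP. Qed.

Program Definition precomp (B C D : Category) (T : Functor B C) :
    Functor (functor_cat C D) (functor_cat B D) :=
  @MkFunctor (functor_cat C D) (functor_cat B D)
    (fun F => functor_comp F T) (fun _ _ s => whisker T s) _ _.
Next Obligation. by move=> B C D T F; apply: nat_ext. Qed.
Next Obligation. by move=> B C D T F G H t s; apply: nat_ext. Qed.

Lemma nat_pack (C D : Category) (F G F' G' : functor_cat C D)
    (s : NatTrans F G) (t : NatTrans F' G') :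
  F = F' -> G = G' -> (forall a, pack (s a) = pack (t a)) ->
  pack (s : @Hom (functor_cat C D) F G) =
  pack (t : @Hom (functor_cat C D) F' G').
Proof.
move=> eF eG; subst F' G' => st; congr pack.
by apply: nat_ext => a; apply: pack_inj.
Qed.

Lemma precomp_id (C D : Category) :
  precomp D (functor_id C) = functor_id (functor_cat C D).
Proof.
have e (F : Functor C D) : functor_comp F (functor_id C) = F.
  exact: functor_ext.
apply: functor_ext => [F|F G s]; first exact: e.
by apply: nat_pack => //; apply: e.
Qed.

Lemma precomp_comp (A B C D : Category) (T : Functor B C) (S : Functor A B) :
  precomp D (functor_comp T S) = functor_comp (precomp D S) (precomp D T).
Proof.
have e (F : Functor C D) :
  functor_comp F (functor_comp T S) = functor_comp (functor_comp F T) S.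
  exact: functor_ext.
apply: functor_ext => [F|F G s]; first exact: e.
by apply: nat_pack => //; apply: e.
Qed.

Definition adjoint_pair (C D : Category) (F : Functor C D) (G : Functor D C) :=
  exists phi : forall (X : C) (Y : D), Hom (F X) Y -> Hom X (G Y),
  [/\ forall X Y, bijective (phi X Y),
      forall (X X' : C) (Y : D) (u : Hom X' X) (f : Hom (F X) Y),
        phi X' Y (f ∘ fmap F u) = phi X Y f ∘ u
    & forall (X : C) (Y Y' : D) (v : Hom Y Y') (f : Hom (F X) Y),
        phi X Y' (v ∘ f) = fmap G v ∘ phi X Y f].

Record InitialObject (C : Category) := MkInitialObject {
  init_ob :> C;
  init_map : forall a, Hom init_ob a;
  init_uniq : forall a (f : Hom init_ob a), f = init_map a
}.

Record FinalObject (C : Category) := MkFinalObject {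
  final_ob :> C;
  final_map : forall a, Hom a final_ob;
  final_uniq : forall a (f : Hom a final_ob), f = final_map a
}.

(* The poset [n] = {0 <= 1 <= ... <= n}. *)
Program Definition ordinal_cat (n : nat) : Category :=
  @MkCategory 'I_n.+1 (fun i j => i <= j) (fun i => leqnn i)
    (fun i j k jk ij => leq_trans ij jk) _ _ _.
Next Obligation. by move=> *; apply: bool_irrelevance. Qed.
Next Obligation. by move=> *; apply: bool_irrelevance. Qed.
Next Obligation. by move=> *; apply: bool_irrelevance. Qed.

(* Functors between the posets [m] and [n] are the monotone maps, i.e. the
   morphisms of the simplex category. *)
Program Definition monotone (m n : nat) (f : 'I_m.+1 -> 'I_n.+1)
    (fP : forall i j : 'I_m.+1, i <= j -> f i <= f j) :
    Functor (ordinal_cat m) (ordinal_cat n) :=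
  @MkFunctor (ordinal_cat m) (ordinal_cat n) f fP _ _.
Next Obligation. by move=> *; apply: bool_irrelevance. Qed.
Next Obligation. by move=> *; apply: bool_irrelevance. Qed.

Lemma coface_mono (n : nat) (i : 'I_n.+2) (j k : 'I_n.+1) :
  j <= k -> lift i j <= lift i k.
Proof. by rewrite /= leq_bump2. Qed.

(* The injection [n] -> [n+1] missing i. *)
Definition coface (n : nat) (i : 'I_n.+2) :
    Functor (ordinal_cat n) (ordinal_cat n.+1) :=
  monotone (@coface_mono n i).

Lemma codegen_subproof (n : nat) (i : 'I_n.+1) (j : 'I_n.+2) :
  unbump i j < n.+1.
Proof.
rewrite /unbump; case: (ltnP i j) => ij.
  by rewrite subn1 prednK ?(leq_ltn_trans _ ij) // -ltnS ltn_ord.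
by rewrite subn0 (leq_ltn_trans ij).
Qed.

Definition codegen_fun (n : nat) (i : 'I_n.+1) (j : 'I_n.+2) : 'I_n.+1 :=
  Ordinal (codegen_subproof i j).

Lemma codegen_mono (n : nat) (i : 'I_n.+1) (j k : 'I_n.+2) :
  j <= k -> codegen_fun i j <= codegen_fun i k.
Proof.
rewrite /= /unbump; case: (ltnP i j) => ij jk.
  by rewrite (leq_trans ij jk) leq_sub2r.
case: (ltnP i k) => ik; last by rewrite !subn0.
by rewrite subn0 subn1 (leq_trans ij) // -ltnS (ltn_predK ik).
Qed.

(* The surjection [n+1] -> [n] taking the value i twice. *)
Definition codegen (n : nat) (i : 'I_n.+1) :
    Functor (ordinal_cat n.+1) (ordinal_cat n) :=
  monotone (@codegen_mono n i).

Record SimplicialCategory := MkSimplicialCategory {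
  scat :> nat -> Category;
  smap : forall m n,
    Functor (ordinal_cat m) (ordinal_cat n) -> Functor (scat n) (scat m);
  smap1 : forall n, smap (functor_id (ordinal_cat n)) = functor_id (scat n);
  smapM : forall k m n (T : Functor (ordinal_cat m) (ordinal_cat n))
      (S : Functor (ordinal_cat k) (ordinal_cat m)),
    smap (functor_comp T S) = functor_comp (smap S) (smap T)
}.

Definition face (N : SimplicialCategory) (n : nat) (i : 'I_n.+2) :
  Functor (N n.+1) (N n) := smap N (coface i).

Definition degen (N : SimplicialCategory) (n : nat) (i : 'I_n.+1) :
  Functor (N n) (N n.+1) := smap N (codegen i).

Definition nerve (M : Category) : SimplicialCategory :=
  @MkSimplicialCategory (fun n => functor_cat (ordinal_cat n) M)
    (fun m n T => precomp M T)
    (fun n => precomp_id (ordinal_cat n) M)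
    (fun k m n T S => precomp_comp M T S).

Definition entry (M : Category) (n : nat) (X : nerve M n) (i : 'I_n.+1) : M :=
  fob (X : Functor (ordinal_cat n) M) i.

(* [n+1] is [n] with a bottom element adjoined: [unlift ord0 i] is [None] for
   i = 0 and [Some j] for i = j + 1. *)
Definition le_bot (n : nat) (o p : option 'I_n) : bool :=
  match o, p with
  | None, _ => true
  | Some _, None => false
  | Some i, Some j => i <= j
  end.

Lemma unlift_bot (n : nat) (i j : 'I_n.+2) :
  i <= j -> le_bot (unlift ord0 i) (unlift ord0 j).
Proof. by case: unliftP => [i'|] ->; case: unliftP => [j'|] ->. Qed.

Section AddInitial.
Variables (M : Category) (I : InitialObject M) (n : nat).
Implicit Types X Y Z : Functor (ordinal_cat n) M.

Definition addi_ob X (o : option 'I_n.+1) : M :=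
  if o is Some i then X i else I.

Definition addi_map X (o p : option 'I_n.+1) :
    le_bot o p -> Hom (addi_ob X o) (addi_ob X p) :=
  match o, p return le_bot o p -> Hom (addi_ob X o) (addi_ob X p) with
  | None, p => fun _ => init_map I (addi_ob X p)
  | Some _, None => fun ij => False_rect _ (notF ij)
  | Some i, Some j => fun ij => @fmap _ _ X i j ij
  end.

Lemma addi_map1 X o (oo : le_bot o o) : addi_map X oo = idm (addi_ob X o).
Proof.
case: o oo => [i|] oo /=; last exact/esym/init_uniq.
by rewrite (bool_irrelevance oo (leqnn i)); apply: (fmap1 X).
Qed.

Lemma addi_mapM X o p q (pq : le_bot p q) (op : le_bot o p) (oq : le_bot o q) :
  addi_map X oq = addi_map X pq ∘ addi_map X op.
Proof.
case: o p q pq op oq => [i|] [j|] [k|] //= pq op oq;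
  try exact/esym/init_uniq.
by rewrite -(@fmapM _ _ X i j k pq op); congr fmap; apply: bool_irrelevance.
Qed.

Definition addi X : Functor (ordinal_cat n.+1) M :=
  @MkFunctor (ordinal_cat n.+1) M (fun i => addi_ob X (unlift ord0 i))
    (fun i j ij => addi_map X (unlift_bot ij))
    (fun i => addi_map1 X _)
    (fun i j k jk ij => addi_mapM X _ _ _).

Definition addi_nat_ob X Y (s : NatTrans X Y) (o : option 'I_n.+1) :
    Hom (addi_ob X o) (addi_ob Y o) :=
  if o is Some i then s i else idm I.

Lemma addi_natP X Y (s : NatTrans X Y) o p (op : le_bot o p) :
  addi_nat_ob s p ∘ addi_map X op = addi_map Y op ∘ addi_nat_ob s o.
Proof.
case: o p op => [i|] [j|] //= op; first exact: (@natP _ _ _ _ s i j op).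
- exact: eq_trans (init_uniq _) (esym (init_uniq _)).
- by rewrite comp1m compm1.
Qed.

Definition addi_nat X Y (s : NatTrans X Y) : NatTrans (addi X) (addi Y) :=
  @MkNatTrans _ _ (addi X) (addi Y) (fun i => addi_nat_ob s (unlift ord0 i))
    (fun i j ij => addi_natP s (unlift_bot ij)).

Lemma addi_nat1 X : addi_nat (nat_id X) = nat_id (addi X).
Proof. by apply: nat_ext => i /=; case: (unlift _ _). Qed.

Lemma addi_natM X Y Z (t : NatTrans Y Z) (s : NatTrans X Y) :
  addi_nat (nat_comp t s) = nat_comp (addi_nat t) (addi_nat s).
Proof. by apply: nat_ext => i /=; case: (unlift _ _) => //=; rewrite comp1m. Qed.

End AddInitial.

(* (X_0 -> ... -> X_n) |-> (I -> X_0 -> ... -> X_n) *)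
Definition degen_init (M : Category) (I : InitialObject M) (n : nat) :
    Functor (nerve M n) (nerve M n.+1) :=
  @MkFunctor (nerve M n) (nerve M n.+1) (@addi M I n) (@addi_nat M I n)
    (@addi_nat1 M I n) (@addi_natM M I n).

(* [n+1] is [n] with a top element adjoined: [unlift ord_max i] is [None] for
   i = n + 1 and [Some i] for i <= n. *)
Definition le_top (n : nat) (o p : option 'I_n) : bool :=
  match o, p with
  | _, None => true
  | None, Some _ => false
  | Some i, Some j => i <= j
  end.

Lemma unlift_top (n : nat) (i j : 'I_n.+2) :
  i <= j -> le_top (unlift ord_max i) (unlift ord_max j).
Proof.
case: unliftP => [i'|] ->; case: unliftP => [j'|] -> //.
  by rewrite /= leq_bump2.
by rewrite lift_max leqNgt ltn_ord.
Qed.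

Section AddFinal.
Variables (M : Category) (T : FinalObject M) (n : nat).
Implicit Types X Y Z : Functor (ordinal_cat n) M.

Definition addf_ob X (o : option 'I_n.+1) : M :=
  if o is Some i then X i else T.

Definition addf_map X (o p : option 'I_n.+1) :
    le_top o p -> Hom (addf_ob X o) (addf_ob X p) :=
  match o, p return le_top o p -> Hom (addf_ob X o) (addf_ob X p) with
  | o, None => fun _ => final_map T (addf_ob X o)
  | None, Some _ => fun ij => False_rect _ (notF ij)
  | Some i, Some j => fun ij => @fmap _ _ X i j ij
  end.

Lemma addf_map1 X o (oo : le_top o o) : addf_map X oo = idm (addf_ob X o).
Proof.
case: o oo => [i|] oo /=; last exact/esym/final_uniq.
by rewrite (bool_irrelevance oo (leqnn i)); apply: (fmap1 X).
Qed.

Lemma addf_mapM X o p q (pq : le_top p q) (op : le_top o p) (oq : le_top o q) :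
  addf_map X oq = addf_map X pq ∘ addf_map X op.
Proof.
case: o p q pq op oq => [i|] [j|] [k|] //= pq op oq;
  try exact/esym/final_uniq.
by rewrite -(@fmapM _ _ X i j k pq op); congr fmap; apply: bool_irrelevance.
Qed.

Definition addf X : Functor (ordinal_cat n.+1) M :=
  @MkFunctor (ordinal_cat n.+1) M (fun i => addf_ob X (unlift ord_max i))
    (fun i j ij => addf_map X (unlift_top ij))
    (fun i => addf_map1 X _)
    (fun i j k jk ij => addf_mapM X _ _ _).

Definition addf_nat_ob X Y (s : NatTrans X Y) (o : option 'I_n.+1) :
    Hom (addf_ob X o) (addf_ob Y o) :=
  if o is Some i then s i else idm T.

Lemma addf_natP X Y (s : NatTrans X Y) o p (op : le_top o p) :
  addf_nat_ob s p ∘ addf_map X op = addf_map Y op ∘ addf_nat_ob s o.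
Proof.
case: o p op => [i|] [j|] //= op; first exact: (@natP _ _ _ _ s i j op).
- exact: eq_trans (final_uniq _) (esym (final_uniq _)).
- by rewrite comp1m compm1.
Qed.

Definition addf_nat X Y (s : NatTrans X Y) : NatTrans (addf X) (addf Y) :=
  @MkNatTrans _ _ (addf X) (addf Y) (fun i => addf_nat_ob s (unlift ord_max i))
    (fun i j ij => addf_natP s (unlift_top ij)).

Lemma addf_nat1 X : addf_nat (nat_id X) = nat_id (addf X).
Proof. by apply: nat_ext => i /=; case: (unlift _ _). Qed.

Lemma addf_natM X Y Z (t : NatTrans Y Z) (s : NatTrans X Y) :
  addf_nat (nat_comp t s) = nat_comp (addf_nat t) (addf_nat s).
Proof. by apply: nat_ext => i /=; case: (unlift _ _) => //=; rewrite comp1m. Qed.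

End AddFinal.

(* (X_0 -> ... -> X_n) |-> (X_0 -> ... -> X_n -> T) *)
Definition degen_final (M : Category) (T : FinalObject M) (n : nat) :
    Functor (nerve M n) (nerve M n.+1) :=
  @MkFunctor (nerve M n) (nerve M n.+1) (@addf M T n) (@addf_nat M T n)
    (@addf_nat1 M T n) (@addf_natM M T n).

Definition only_new_entries (M : Category) (I : InitialObject M)
    (T : FinalObject M) (m n : nat) (F : Functor (nerve M m) (nerve M n)) :=
  forall (X : nerve M m) (j : 'I_n.+1),
    [\/ exists k : 'I_m.+1, entry (F X) j = entry X k,
        entry (F X) j = I
      | entry (F X) j = T].

(* Main.v *)
Require Import Defs.
From mathcomp Require Import all_boot zify.

(** Every adjunction here is given by a unit and a counit satisfying the
    triangle identities ([adjoint_pair_unit_counit]).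

    Faces and degeneracies are precomposition with monotone maps between finite
    ordinals.  Precomposition is 2-functorial and reverses the direction of
    functors but not of natural transformations, so an adjunction [L] left
    adjoint to [R] turns into an adjunction in which [precomp R] is left adjoint
    to [precomp L] ([adjoint_pair_precomp]).  Between posets an adjunction is a
    Galois connection ([adjoint_pair_galois]), and there are two of them at each
    index [i]: the surjection hitting [i] twice is left adjoint to the injection
    missing [i], and right adjoint to the injection missing [i + 1].  These give
    the adjunctions [(d_i, s_i)] and [(s_i, d_{i+1})].

    For the two remaining adjunctions, deleting the object just added returns
    the original chain, so one of the unit and the counit is invertible.  The
    other one compares a chain with the chain in which an end has been replaced
    by the initial or the final object; it consists of identities and of one map
    out of the initial or into the final object, so that every equation to be
    checked at that end holds by uniqueness of such a map
    ([adjoint_pair_degen_init], [adjoint_pair_degen_final]).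

    Precomposition with a map of ordinals only repeats or drops entries, and the
    two extra degeneracies add a single one, so the claim on new entries is read
    off the formulas. *)

Set Implicit Arguments.
Unset Strict Implicit.
Unset Printing Implicit Defensive.

Local Open Scope cat_scope.

(** * Adjunctions from units and counits *)

Lemma adjoint_pair_unit_counit (C D : Category)
    (F : Functor C D) (G : Functor D C)
    (eta : NatTrans (functor_id C) (functor_comp G F))
    (eps : NatTrans (functor_comp F G) (functor_id D)) :
  (forall X, eps (F X) ∘ fmap F (eta X) = idm (F X)) ->
  (forall Y, fmap G (eps Y) ∘ eta (G Y) = idm (G Y)) ->
  adjoint_pair F G.
Proof.
move=> tF tG; exists (fun X Y f => fmap G f ∘ eta X); split.
- move=> X Y; exists (fun g => eps Y ∘ fmap F g) => [f|g].
  + have epsP := natP eps f; rewrite /= in epsP.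
    by rewrite fmapM Defs.compA epsP -Defs.compA tF compm1.
  + have etaP := natP eta g; rewrite /= in etaP.
    by rewrite fmapM -Defs.compA -etaP Defs.compA tG comp1m.
- move=> X X' Y u f; have etaP := natP eta u; rewrite /= in etaP.
  by rewrite fmapM -Defs.compA -etaP Defs.compA.
- by move=> X Y Y' v f; rewrite fmapM Defs.compA.
Qed.

Section Precomposition.
Variables (A B M : Category) (L : Functor A B) (R : Functor B A).
Variable eta : NatTrans (functor_id A) (functor_comp R L).
Variable eps : NatTrans (functor_comp L R) (functor_id B).

Lemma precomp_unit_subproof (X : Functor A M) a b (f : Hom a b) :
  fmap X (eta b) ∘ fmap X f = fmap X (fmap R (fmap L f)) ∘ fmap X (eta a).
Proof. by rewrite -!fmapM; congr fmap; apply: (natP eta f). Qed.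

Definition precomp_unit_ob (X : Functor A M) :
    NatTrans X (functor_comp (functor_comp X R) L) :=
  @MkNatTrans _ _ X (functor_comp (functor_comp X R) L)
    (fun a => fmap X (eta a)) (@precomp_unit_subproof X).

Lemma precomp_unitP (X Y : functor_cat A M) (s : Hom X Y) :
  nat_comp (precomp_unit_ob Y) s =
  nat_comp (whisker L (whisker R s)) (precomp_unit_ob X).
Proof. by apply: nat_ext => a /=; rewrite natP. Qed.

Definition precomp_unit :
    NatTrans (functor_id (functor_cat A M))
             (functor_comp (precomp M L) (precomp M R)) :=
  @MkNatTrans _ _ (functor_id (functor_cat A M))
    (functor_comp (precomp M L) (precomp M R))
    precomp_unit_ob precomp_unitP.

Lemma precomp_counit_subproof (Y : Functor B M) a b (f : Hom a b) :
  fmap Y (eps b) ∘ fmap Y (fmap L (fmap R f)) = fmap Y f ∘ fmap Y (eps a).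
Proof. by rewrite -!fmapM; congr fmap; apply: (natP eps f). Qed.

Definition precomp_counit_ob (Y : Functor B M) :
    NatTrans (functor_comp (functor_comp Y L) R) Y :=
  @MkNatTrans _ _ (functor_comp (functor_comp Y L) R) Y
    (fun b => fmap Y (eps b)) (@precomp_counit_subproof Y).

Lemma precomp_counitP (X Y : functor_cat B M) (s : Hom X Y) :
  nat_comp (precomp_counit_ob Y) (whisker R (whisker L s)) =
  nat_comp s (precomp_counit_ob X).
Proof. by apply: nat_ext => b /=; rewrite natP. Qed.

Definition precomp_counit :
    NatTrans (functor_comp (precomp M R) (precomp M L))
             (functor_id (functor_cat B M)) :=
  @MkNatTrans _ _ (functor_comp (precomp M R) (precomp M L))
    (functor_id (functor_cat B M))
    precomp_counit_ob precomp_counitP.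

(** The unit and the counit keep their roles, but the two triangle identities
    are exchanged: this is why the left adjoint is precomposition with [R]. *)
Lemma adjoint_pair_precomp :
  (forall a, eps (L a) ∘ fmap L (eta a) = idm (L a)) ->
  (forall b, fmap R (eps b) ∘ eta (R b) = idm (R b)) ->
  adjoint_pair (precomp M R) (precomp M L).
Proof.
move=> tL tR.
apply: (@adjoint_pair_unit_counit _ _ _ _ precomp_unit precomp_counit).
  by move=> X; apply: nat_ext => b /=; rewrite -fmapM tR fmap1.
by move=> Y; apply: nat_ext => a /=; rewrite -fmapM tL fmap1.
Qed.

End Precomposition.

(** * Faces and degeneracies *)

(** In a poset all parallel morphisms are equal, so naturality and the triangle
    identities are automatic and only the Galois connection remains. *)
Lemma adjoint_pair_galois (M : Category) (m n : nat)
    (L : Functor (ordinal_cat m) (ordinal_cat n))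
    (R : Functor (ordinal_cat n) (ordinal_cat m)) :
  (forall (a : 'I_m.+1) (b : 'I_n.+1),
     ((L a : 'I_n.+1) <= b) = (a <= (R b : 'I_m.+1))) ->
  adjoint_pair (precomp M R) (precomp M L).
Proof.
move=> LR.
have eta_le (a : 'I_m.+1) : a <= (R (L a) : 'I_m.+1) by rewrite -LR.
have eps_le (b : 'I_n.+1) : (L (R b) : 'I_n.+1) <= b by rewrite LR.
pose eta := @MkNatTrans _ _ (functor_id (ordinal_cat m)) (functor_comp R L)
  eta_le (fun _ _ _ => bool_irrelevance _ _).
pose eps := @MkNatTrans _ _ (functor_comp L R) (functor_id (ordinal_cat n))
  eps_le (fun _ _ _ => bool_irrelevance _ _).
by apply: (@adjoint_pair_precomp _ _ M L R eta eps) => ?;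
  apply: bool_irrelevance.
Qed.

Lemma adjoint_pair_face_degen (M : Category) (n : nat) (i : 'I_n.+1) :
  adjoint_pair (face (nerve M) (widen_ord (leqnSn n.+1) i))
               (degen (nerve M) i).
Proof. by apply: adjoint_pair_galois => a b /=; rewrite leq_bump. Qed.

Lemma leq_bumpS (i j k : nat) : (bump i.+1 j <= k) = (j <= unbump i k).
Proof. by rewrite /bump /unbump; lia. Qed.

Lemma adjoint_pair_degen_face (M : Category) (n : nat) (i : 'I_n.+1) :
  adjoint_pair (degen (nerve M) i) (face (nerve M) (lift ord0 i)).
Proof. by apply: adjoint_pair_galois => a b; apply: leq_bumpS. Qed.

(** * Adjoining an initial object *)

Section AdjoinInitial.
Variables (M : Category) (I : InitialObject M) (n : nat).
Implicit Types X Y : nerve M n.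
Implicit Types Z W : nerve M n.+1.

Let d0 : Functor (nerve M n.+1) (nerve M n) := face (nerve M) ord0.
Let s_init : Functor (nerve M n) (nerve M n.+1) := degen_init I n.

Lemma le_bot_lift (i : 'I_n.+1) : le_bot (Some i) (unlift ord0 (lift ord0 i)).
Proof. by rewrite liftK /=. Qed.

Lemma addi_unit_subproof X (i j : 'I_n.+1) (ij : i <= j) :
  addi_map I X (le_bot_lift j) ∘ fmap X (ij : Hom (i : ordinal_cat n) j) =
  fmap (s_init X)
    (coface_mono ord0 ij : Hom (lift ord0 i : ordinal_cat n.+1) (lift ord0 j))
    ∘ addi_map I X (le_bot_lift i).
Proof.
have ilj : le_bot (Some i) (unlift ord0 (lift ord0 j)) by rewrite liftK.
rewrite /= -(addi_mapM I X _ _ ilj).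
exact: esym (@addi_mapM M I n X (Some i) (Some j) _ _ _ _).
Qed.

(** Position [i] of [X] is carried into [addi X] by a structure map of [addi X]:
    its source is [X i] by computation and its target is [X i] only up to
    [liftK], so that no transport along [liftK] is needed. *)
Definition addi_unit_ob X : NatTrans X (d0 (s_init X)) :=
  @MkNatTrans _ _ X (d0 (s_init X))
    (fun i => addi_map I X (le_bot_lift i)) (@addi_unit_subproof X).

Lemma addi_unitP X Y (s : Hom X Y) :
  nat_comp (addi_unit_ob Y) s =
  nat_comp (fmap d0 (fmap s_init s)) (addi_unit_ob X).
Proof.
apply: nat_ext => i.
exact: esym (@addi_natP M I n X Y s (Some i) _ (le_bot_lift i)).
Qed.

Definition addi_unit :
    NatTrans (functor_id (nerve M n)) (functor_comp d0 s_init) :=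
  @MkNatTrans _ _ (functor_id (nerve M n)) (functor_comp d0 s_init)
    addi_unit_ob addi_unitP.

(** What is left of the equality [k = lift ord0 i] when [unlift ord0 k] is
    generalized to a variable [o]: the inequality already yields a morphism in
    the chain [Z], again without transport. *)
Definition lift_bot_le (o : option 'I_n.+1) (k : 'I_n.+2) : bool :=
  if o is Some i then lift ord0 i <= k else true.

Lemma unlift_bot_le (k : 'I_n.+2) : lift_bot_le (unlift ord0 k) k.
Proof. by case: unliftP => [i|] ->; rewrite /= ?leqnn. Qed.

Definition addi_out Z (o : option 'I_n.+1) (k : 'I_n.+2) :
    lift_bot_le o k -> Hom (addi_ob I (d0 Z) o) (entry Z k) :=
  match o return lift_bot_le o k -> Hom (addi_ob I (d0 Z) o) (entry Z k) with
  | Some i => fun ik => @fmap _ _ Z (lift ord0 i) k ik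
  | None => fun _ => init_map I (entry Z k)
  end.

Lemma addi_out_natural Z (o p : option 'I_n.+1) (k l : 'I_n.+2)
    (ok : lift_bot_le o k) (pl : lift_bot_le p l) (op : le_bot o p)
    (kl : k <= l) :
  addi_out Z pl ∘ addi_map I (d0 Z) op =
  fmap Z (kl : Hom (k : ordinal_cat n.+1) l) ∘ addi_out Z ok.
Proof.
case: o p ok pl op => [i|] [j|] //= ok pl op;
  try exact: eq_trans (init_uniq _) (esym (init_uniq _)).
by rewrite -!fmapM; congr fmap; apply: bool_irrelevance.
Qed.

Definition addi_counit_ob Z : NatTrans (s_init (d0 Z)) Z :=
  @MkNatTrans _ _ (s_init (d0 Z)) Z
    (fun k => addi_out Z (unlift_bot_le k))
    (fun k l kl => addi_out_natural Z _ _ (unlift_bot kl) kl).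

Lemma addi_counitP Z W (s : Hom Z W) :
  nat_comp (addi_counit_ob W) (fmap s_init (fmap d0 s)) =
  nat_comp s (addi_counit_ob Z).
Proof.
apply: nat_ext => k /=; case: (unlift _ _) (unlift_bot_le k) => [i|] ik /=.
  by rewrite (natP s).
exact: eq_trans (init_uniq _) (esym (init_uniq _)).
Qed.

Definition addi_counit :
    NatTrans (functor_comp s_init d0) (functor_id (nerve M n.+1)) :=
  @MkNatTrans _ _ (functor_comp s_init d0) (functor_id (nerve M n.+1))
    addi_counit_ob addi_counitP.

(** The triangle identity on [addi X], with [unlift ord0 k] replaced by an
    arbitrary [o] in the source so that [o] can be destructed. *)
Lemma addi_out_unit X (o : option 'I_n.+1) (k : 'I_n.+2)
    (ok : lift_bot_le o k) (ok' : le_bot o (unlift ord0 k)) :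
  addi_out (s_init X) ok ∘ addi_nat_ob I (addi_unit_ob X) o =
  addi_map I X ok'.
Proof.
case: o ok ok' => [i|] ok ok' /=;
  last exact: eq_trans (init_uniq _) (esym (init_uniq _)).
exact: esym (addi_mapM I X (unlift_bot ok) (le_bot_lift i) ok').
Qed.

(** The triangle identity on [d0 Z]; by the first hypothesis [o] cannot be the
    new bottom position, so the initial object never intervenes. *)
Lemma addi_out_lift Z (i : 'I_n.+1) (o : option 'I_n.+1) (k : 'I_n.+2)
    (io : le_bot (Some i) o) (ok : lift_bot_le o k) (ik : lift ord0 i <= k) :
  addi_out Z ok ∘ addi_map I (d0 Z) io =
  fmap Z (ik : Hom (lift ord0 i : ordinal_cat n.+1) k).
Proof.
case: o io ok => [j|] //= io ok.
by rewrite -fmapM; congr fmap; apply: bool_irrelevance.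
Qed.

Lemma adjoint_pair_degen_init : adjoint_pair s_init d0.
Proof.
apply: (@adjoint_pair_unit_counit _ _ _ _ addi_unit addi_counit) => [X|Z].
  apply: nat_ext => k /=; have kk := unlift_bot (leqnn k).
  by rewrite (addi_out_unit X _ kk) addi_map1.
apply: nat_ext => i /=.
by rewrite (addi_out_lift Z _ _ (leqnn (lift ord0 i))); apply: (fmap1 Z).
Qed.

End AdjoinInitial.

(** * Adjoining a final object *)

Section AdjoinFinal.
Variables (M : Category) (T : FinalObject M) (n : nat).
Implicit Types X Y : nerve M n.
Implicit Types Z W : nerve M n.+1.

Let d_max : Functor (nerve M n.+1) (nerve M n) := face (nerve M) ord_max.
Let s_final : Functor (nerve M n) (nerve M n.+1) := degen_final T n.

Lemma le_top_lift (i : 'I_n.+1) :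
  le_top (unlift ord_max (lift ord_max i)) (Some i).
Proof. by rewrite liftK /=. Qed.

Lemma addf_counit_subproof X (i j : 'I_n.+1) (ij : i <= j) :
  addf_map T X (le_top_lift j) ∘
    fmap (s_final X)
      (coface_mono ord_max ij :
         Hom (lift ord_max i : ordinal_cat n.+1) (lift ord_max j)) =
  fmap X (ij : Hom (i : ordinal_cat n) j) ∘ addf_map T X (le_top_lift i).
Proof.
have lij : le_top (unlift ord_max (lift ord_max i)) (Some j) by rewrite liftK.
rewrite /= -(addf_mapM T X _ _ lij).
exact: (@addf_mapM M T n X _ (Some i) (Some j) ij (le_top_lift i) lij).
Qed.

(** As in [addi_unit_ob], a structure map of [addf X] with target [X i] by
    computation. *)
Definition addf_counit_ob X : NatTrans (d_max (s_final X)) X :=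
  @MkNatTrans _ _ (d_max (s_final X)) X
    (fun i => addf_map T X (le_top_lift i)) (@addf_counit_subproof X).

Lemma addf_counitP X Y (s : Hom X Y) :
  nat_comp (addf_counit_ob Y) (fmap d_max (fmap s_final s)) =
  nat_comp s (addf_counit_ob X).
Proof.
apply: nat_ext => i.
exact: esym (@addf_natP M T n X Y s _ (Some i) (le_top_lift i)).
Qed.

Definition addf_counit :
    NatTrans (functor_comp d_max s_final) (functor_id (nerve M n)) :=
  @MkNatTrans _ _ (functor_comp d_max s_final) (functor_id (nerve M n))
    addf_counit_ob addf_counitP.

Definition lift_top_ge (o : option 'I_n.+1) (k : 'I_n.+2) : bool :=
  if o is Some i then k <= lift ord_max i else true.

Lemma unlift_top_ge (k : 'I_n.+2) : lift_top_ge (unlift ord_max k) k.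
Proof. by case: unliftP => [i|] ->; rewrite /lift_top_ge ?leqnn. Qed.

Definition addf_in Z (o : option 'I_n.+1) (k : 'I_n.+2) :
    lift_top_ge o k -> Hom (entry Z k) (addf_ob T (d_max Z) o) :=
  match o return lift_top_ge o k -> Hom (entry Z k) (addf_ob T (d_max Z) o) with
  | Some i => fun ki => @fmap _ _ Z k (lift ord_max i) ki
  | None => fun _ => final_map T (entry Z k)
  end.

Lemma addf_in_natural Z (o p : option 'I_n.+1) (k l : 'I_n.+2)
    (ok : lift_top_ge o k) (pl : lift_top_ge p l) (op : le_top o p)
    (kl : k <= l) :
  addf_in Z pl ∘ fmap Z (kl : Hom (k : ordinal_cat n.+1) l) =
  addf_map T (d_max Z) op ∘ addf_in Z ok.
Proof.
case: o p ok pl op => [i|] [j|] //= ok pl op;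
  try exact: eq_trans (final_uniq _) (esym (final_uniq _)).
by rewrite -!fmapM; congr fmap; apply: bool_irrelevance.
Qed.

Definition addf_unit_ob Z : NatTrans Z (s_final (d_max Z)) :=
  @MkNatTrans _ _ Z (s_final (d_max Z))
    (fun k => addf_in Z (unlift_top_ge k))
    (fun k l kl => addf_in_natural Z _ _ (unlift_top kl) kl).

Lemma addf_unitP Z W (s : Hom Z W) :
  nat_comp (addf_unit_ob W) s =
  nat_comp (fmap s_final (fmap d_max s)) (addf_unit_ob Z).
Proof.
apply: nat_ext => k /=; case: (unlift _ _) (unlift_top_ge k) => [i|] ki /=.
  by rewrite (natP s).
exact: eq_trans (final_uniq _) (esym (final_uniq _)).
Qed.

Definition addf_unit :
    NatTrans (functor_id (nerve M n.+1)) (functor_comp s_final d_max) :=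
  @MkNatTrans _ _ (functor_id (nerve M n.+1)) (functor_comp s_final d_max)
    addf_unit_ob addf_unitP.

Lemma addf_counit_in X (o : option 'I_n.+1) (k : 'I_n.+2)
    (ok : lift_top_ge o k) (ok' : le_top (unlift ord_max k) o) :
  addf_nat_ob T (addf_counit_ob X) o ∘ addf_in (s_final X) ok =
  addf_map T X ok'.
Proof.
case: o ok ok' => [i|] ok ok' /=;
  last exact: eq_trans (final_uniq _) (esym (final_uniq _)).
exact: esym (addf_mapM T X (le_top_lift i) (unlift_top ok) ok').
Qed.

Lemma addf_in_lift Z (i : 'I_n.+1) (o : option 'I_n.+1) (k : 'I_n.+2)
    (oi : le_top o (Some i)) (ok : lift_top_ge o k) (ki : k <= lift ord_max i) :
  addf_map T (d_max Z) oi ∘ addf_in Z ok =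
  fmap Z (ki : Hom (k : ordinal_cat n.+1) (lift ord_max i)).
Proof.
case: o oi ok => [j|] //= oi ok.
by rewrite -fmapM; congr fmap; apply: bool_irrelevance.
Qed.

Lemma adjoint_pair_degen_final : adjoint_pair d_max s_final.
Proof.
apply: (@adjoint_pair_unit_counit _ _ _ _ addf_unit addf_counit) => [Z|X].
  apply: nat_ext => i /=.
  by rewrite (addf_in_lift Z _ _ (leqnn (lift ord_max i))); apply: (fmap1 Z).
apply: nat_ext => k /=; have kk := unlift_top (leqnn k).
by rewrite (addf_counit_in X _ kk) addf_map1.
Qed.

End AdjoinFinal.

(** * Adjunctions and entries in the nerve *)

Theorem lemma7p3 (M : Category) (I : InitialObject M) (T : FinalObject M)
    (n : nat) :
  (forall i : 'I_n.+1,
     adjoint_pair (face (nerve M) (widen_ord (leqnSn n.+1) i))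
                  (degen (nerve M) i)
     /\ adjoint_pair (degen (nerve M) i)
                     (face (nerve M) (lift ord0 i)))
  /\ adjoint_pair (degen_init I n) (face (nerve M) ord0)
  /\ adjoint_pair (face (nerve M) ord_max) (degen_final T n)
  /\ (forall i : 'I_n.+2, only_new_entries I T (face (nerve M) i))
  /\ (forall i : 'I_n.+1, only_new_entries I T (degen (nerve M) i))
  /\ only_new_entries I T (degen_init I n)
  /\ only_new_entries I T (degen_final T n).
Proof.
split=> [i|].
  by split; [apply: adjoint_pair_face_degen | apply: adjoint_pair_degen_face].
split; first exact: adjoint_pair_degen_init.
split; first exact: adjoint_pair_degen_final.
split=> [i X j|]; first by apply: Or31; exists (lift i j).
split=> [i X j|]; first by apply: Or31; exists (codegen_fun i j).
split=> X j; rewrite /entry /=; case: (unlift _ j) => [k|].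
- by apply: Or31; exists k.
- exact: Or32.
- by apply: Or31; exists k.
- exact: Or33.
Qed.
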